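(* For every $n\ge2$, the set of synthetic flag positroids on $[n]$ equals the set of realizable flag positroids on $[n]$. That is, for every complete flag $F$ with $P_I(F)\ge0$ for all $I\subset[n]$ there is a flag $F'\in Fl_n^{\ge0}$ with $\{I:P_I(F')\ne0\}=\{I:P_I(F)\ne0\}$ (and conversely).
   Context: A complete flag in $\mathbb R^n$ is a chain $\{0\}=V_0\subsetneq V_1\subsetneq\cdots\subsetneq V_n=\mathbb R^n$; $Fl_n$ is the set of them. A flag is represented by an invertible real $n\times n$ matrix $M$ whose first $i$ rows span $V_i$; two matrices represent the same flag iff they differ by left multiplication by an invertible lower triangular matrix. For $I\subset[n]$, $P_I(M)$ is the determinant of the submatrix of $M$ in rows $\{1,\dots,|I|\}$ and columns $I$; the set $\{I: P_I(F)\neq 0\}$ is independent of the representative. ''$P_I(F)\ge0$ for all $I$'' means some representative $M$ has $P_I(M)\ge0$ for all $I$. $Fl_n^{\ge0}$ (Lusztig): for $1\le k<n$, $x_k(a)$ is the identity matrix with an extra entry $a$ in row $k$, column $k+1$; with $s_i=(i,i+1)$, $N=\binom n2$ and $s_{i_1}\cdots s_{i_N}=w_0$ the longest permutation, $U^+_{>0}=\{x_{i_1}(a_1)\cdots x_{i_N}(a_N):a_i>0\}$, and $Fl_n^{\ge0}$ is the closure in $Fl_n$ of the set of flags represented by elements of $U^+_{>0}$. A realizable flag positroid on $[n]$ is the set $\{I\subset[n]:P_I(F)\ne0\}$ for some $F\in Fl_n^{\ge0}$. A synthetic flag positroid on $[n]$ is the set $\{I\subset[n]:P_I(F)\ne0\}$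 for some $F\in Fl_n$ with $P_I(F)\ge0$ for all $I$. *)

(* Defs.v *)
From mathcomp Require Import all_boot all_order all_algebra.
From mathcomp Require Import reals.
Set Implicit Arguments. Unset Strict Implicit. Unset Printing Implicit Defensive.
Import Order.TTheory GRing.Theory Num.Theory.
Local Open Scope ring_scope.

Section Flags.
Variables (R : realType) (n : nat).

Lemma card_set_le_n (I : {set 'I_n}) : (#|I| <= n)%N.
Proof. by rewrite -[X in (_ <= X)%N]card_ord; apply: max_card. Qed.

Definition plucker (I : {set 'I_n}) (M : 'M[R]_n) : R :=
  \det (mxsub (fun r : 'I_#|I| => widen_ord (card_set_le_n I) r)
              (fun c : 'I_#|I| => enum_val c) M).

Definition lower_inv (L : 'M[R]_n) : Prop :=
  L \in unitmx /\ forall i j : 'I_n, (i < j)%N -> L i j = 0.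

Definition same_flag (M N : 'M[R]_n) : Prop :=
  exists L, lower_inv L /\ N = L *m M.

(* x_k(a), k in 1..n-1 (1-based): identity plus a in row k, column k+1. *)
Definition xk (k : nat) (a : R) : 'M[R]_n :=
  \matrix_(i, j) ((i == j :> nat)%:R +
                  (if ((i : nat) == k.-1) && ((j : nat) == k) then a else 0)).

(* The reduced word s_1 (s_2 s_1) (s_3 s_2 s_1) ... (s_{n-1} ... s_1) of w_0. *)
Definition w0_word : seq nat :=
  flatten [seq rev (iota 1 j) | j <- iota 1 n.-1].

Fixpoint xprod (w : seq nat) (a : seq R) : 'M[R]_n :=
  match w, a with
  | k :: w', b :: a' => xk k b *m xprod w' a'
  | _, _ => 1%:M
  end.

Definition in_Upos (M : 'M[R]_n) : Prop :=
  exists a : seq R, size a = size w0_word /\ (forall b, b \in a -> 0 < b) /\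
                    M = xprod w0_word a.

Definition rep_Upos_flag (M : 'M[R]_n) : Prop :=
  exists U, in_Upos U /\ same_flag U M.

(* Open subsets of Fl_n (quotient topology of GL_n / lower-triangular group):
   sets of invertible matrices which are open in GL_n (entrywise topology)
   and saturated for the relation same_flag. *)
Definition open_in_GL (O : 'M[R]_n -> Prop) : Prop :=
  forall M, O M -> M \in unitmx /\
    exists e : R, 0 < e /\
      forall N : 'M[R]_n, (forall i j, `|N i j - M i j| < e) ->
                          N \in unitmx -> O N.

Definition flag_saturated (O : 'M[R]_n -> Prop) : Prop :=
  forall M N, O M -> same_flag M N -> O N.

(* M represents a flag in Fl_n^{>=0}: the closure in Fl_n of the flags
   represented by elements of U^+_{>0}. *)
Definition in_Fl_nonneg (M : 'M[R]_n) : Prop :=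
  M \in unitmx /\
  forall O, open_in_GL O -> flag_saturated O -> O M ->
            exists N, O N /\ rep_Upos_flag N.

Definition realizable_flag_positroid (S : {set {set 'I_n}}) : Prop :=
  exists M, in_Fl_nonneg M /\ S = [set I | plucker I M != 0].

Definition synthetic_flag_positroid (S : {set {set 'I_n}}) : Prop :=
  exists M : 'M[R]_n, M \in unitmx /\ (forall I, 0 <= plucker I M) /\
                      S = [set I | plucker I M != 0].

End Flags.

(* Main.v *)
(* In fact the two notions agree flag by flag: F lies in Fl_n^{>=0} iff it has a
   representative with nonnegative flag minors P_I.

   On the closure, P_I P_J >= 0 whenever |I| = |J|, because this holds on U^+_{>0}
   and its failure is an open condition; rescaling the rows of a representative
   by signs then makes all P_I nonnegative.

   Conversely, adding a small positive multiple of a column to a neighbouring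
   one keeps all P_I >= 0 and makes one more of them positive, so a flag with
   P_I >= 0 is a limit of flags with all P_I > 0.  Such a flag lies in U^+_{>0}:
   clear the rows from right to left with column operations x_k(-a), where a is a
   ratio of two flag minors; the three-term Pluecker relations keep the other
   minors positive, and what remains is lower triangular.  The operations used
   form the word (n-1)(n-2 n-1)...(1 ... n-1), and braid moves turn it into the
   word 1 (2 1) (3 2 1) ... (n-1 ... 1). *)
Require Import Defs.
From mathcomp Require Import all_boot all_order all_algebra.
From mathcomp Require Import boolp reals.
From mathcomp Require Import ring lra zify.
Set Implicit Arguments. Unset Strict Implicit. Unset Printing Implicit Defensive.
Import Order.TTheory GRing.Theory Num.Theory.
Local Open Scope ring_scope.

(** * Three-term Pluecker relation *)

Section ColumnDeterminants.
Variable R : fieldType.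
Implicit Types (s t u : seq (nat -> R)) (v x y z : nat -> R).

(** Columns are functions on all of [nat], of which only the first [size s] entries are read. A
    longer list thus brings in further rows, as flag minors do. *)
Definition cdet s : R :=
  \det (\matrix_(i < size s, j < size s) nth (fun=> 0) s j i).

Lemma cdetE k s : size s = k ->
  cdet s = \det (\matrix_(i < k, j < k) nth (fun=> 0) s j i).
Proof. by move=> <-. Qed.

Lemma eq_cdet s t : size s = size t ->
  (forall i j, (i < size s)%N -> (j < size s)%N ->
    nth (fun=> 0) s j i = nth (fun=> 0) t j i) -> cdet s = cdet t.
Proof.
move=> est st; rewrite (cdetE (esym est)) /cdet.
by congr (\det _); apply/matrixP => i j; rewrite !mxE st.
Qed.

(** The weights are cofactors, which do not see [v]. Having one [w] for all [v] makes this
    determinant, as a function of [v], a fixed combination of the entries of [v]. *)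
Lemma cdet_linear s t : exists w : nat -> R, forall v,
  cdet (s ++ v :: t) = \sum_(i < (size s + size t).+1) w i * v i.
Proof.
set k := (size s + size t)%N.
have szk v : size (s ++ v :: t) = k.+1 by rewrite size_cat /= addnS.
have p_lt : (size s < k.+1)%N by rewrite ltnS leq_addr.
pose p := Ordinal p_lt.
pose A v := \matrix_(i < k.+1, j < k.+1) nth (fun=> 0) (s ++ v :: t) j i.
(* Any column may stand at place [p], since the cofactor deletes it. *)
exists (fun i => cofactor (A (fun=> 0)) (inord i) p) => v.
rewrite (cdetE (szk v)) (expand_det_col _ p); apply: eq_bigr => i _.
rewrite mxE nth_cat ltnn subnn /= mulrC inord_val; congr (_ * _).
rewrite /cofactor; congr (_ * \det _); apply/matrixP => i' j'; rewrite !mxE.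
rewrite !nth_cat; case: ltnP => // le_sj.
rewrite /= in le_sj *; case def_m: (_ - _)%N => //; move: def_m le_sj.
by rewrite /bump; case: leqP => /=; lia.
Qed.

Lemma cdet_dup s t u v : cdet (s ++ v :: t ++ v :: u) = 0.
Proof.
set r := s ++ _; have szr : size r = (size s + (size t + size u).+2)%N.
  by rewrite size_cat /= size_cat /=; lia.
have i_lt : (size s < size r)%N by rewrite szr; lia.
have j_lt : (size s + (size t).+1 < size r)%N by rewrite szr; lia.
rewrite /cdet -det_tr.
apply: (@determinant_alternate _ _ _ (Ordinal i_lt) (Ordinal j_lt)) => [|i].
  by rewrite -val_eqE /=; lia.
rewrite !mxE /= /r !nth_cat ltnn subnn /= ltnNge leq_addr addKn /=.
by rewrite nth_cat ltnn subnn.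
Qed.

(** Deleting the last row together with a column leaves a [cdet] again, because a shorter list reads
    fewer rows. *)
Lemma cdet_expand_last k s : size s = k.+1 ->
  cdet s = \sum_(j < k.+1)
    (-1) ^+ (k + j) * nth (fun=> 0) s j k * cdet (take j s ++ drop j.+1 s).
Proof.
move=> szs; rewrite (cdetE szs) (expand_det_row _ ord_max).
apply: eq_bigr => j _; rewrite mxE /cofactor mulrCA mulrA; congr (_ * _ * _).
have sz_jle : (size (take j s) = j)%N by rewrite size_take szs ltn_ord.
rewrite (@cdetE k) ?size_cat ?sz_jle ?size_drop ?szs; last first.
  by have := ltn_ord j; lia.
congr (\det _); apply/matrixP => i' j'; rewrite !mxE /= /bump [(k <= i')%N]leqNgt ltn_ord /= add0n.
rewrite nth_cat sz_jle; case: ltnP => j'j.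
  by rewrite nth_take // ?add0n.
by rewrite nth_drop add1n addSn subnKC.
Qed.

(* A determinant whose last row [F] is a combination of the others vanishes;
   its expansion along that row is the three-term relation. *)
Lemma cdet_three_term s t x y z :
  cdet (s ++ y :: t) * cdet (s ++ x :: z :: t) =
  cdet (s ++ x :: t) * cdet (s ++ y :: z :: t) +
  cdet (s ++ z :: t) * cdet (s ++ x :: y :: t).
Proof.
pose F v := cdet (s ++ v :: t).
have [w Fw] := cdet_linear s t.
set p := (size s + size t)%N in Fw.
have Fs j : (j < size s)%N -> F (nth (fun=> 0) s j) = 0.
  move=> ltj; rewrite /F -{1}(cat_take_drop j s) (drop_nth (fun=> 0)) //.
  by rewrite -catA cat_cons cdet_dup.
have Ft j : (j < size t)%N -> F (nth (fun=> 0) t j) = 0.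
  move=> ltj; rewrite /F -{2}(cat_take_drop j t) (drop_nth (fun=> 0)) //.
  by rewrite cdet_dup.
pose ext v (i : nat) := if i == p.+2 then F v else v i.
set a := s ++ x :: y :: z :: t.
have sza : size a = p.+3 by rewrite /a size_cat /= !addnS.
(* Once a column is deleted, only rows up to [p.+1] are read, so the altered row [p.+2] is
   invisible. *)
have ext_cdet u : size u = p.+2 -> cdet (map ext u) = cdet u.
  move=> szu; apply: eq_cdet => [|i j]; rewrite ?size_map // => lti ltj.
  by rewrite (nth_map (fun=> 0)) // /ext ltn_eqF // -szu.
have : cdet (map ext a) = 0.
  rewrite (@cdetE p.+3) ?size_map //; apply/eqP/det0P.
  (* A left kernel vector: [F] combines the first [p.+1] rows with weights [w], so row [p.+1] gets
     weight 0 and the row of [F] gets -1. *)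
  exists (\row_(i < p.+3) (if i == p.+2 :> nat then -1 else
                           if (i < p.+1)%N then w i else 0)).
    apply/eqP => /rowP /(_ ord_max); rewrite !mxE eqxx => /eqP.
    by rewrite oppr_eq0 oner_eq0.
  apply/rowP => j; rewrite !mxE 2!big_ord_recr /= !mxE /=.
  rewrite eqxx (nth_map (fun=> 0)) ?sza // /ext eqxx ltnn.
  rewrite !ltn_eqF //= mul0r addr0 mulN1r.
  apply/eqP; rewrite subr_eq0; apply/eqP; rewrite /F Fw.
  apply: eq_bigr => i _; rewrite !mxE /= (nth_map (fun=> 0)) ?sza //.
  have lt_ip := ltn_ord i.
  by rewrite !ltn_eqF ?lt_ip // (ltn_trans lt_ip).
rewrite (@cdet_expand_last p.+2) ?size_map //.
set m := size s.
have -> : p.+3 = (m + (3 + size t))%N by rewrite /p /m; lia.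
rewrite -(big_mkord xpredT (fun j => (-1) ^+ (p.+2 + j) * nth (fun=> 0) (map ext a) j p.+2
  * cdet (take j (map ext a) ++ drop j.+1 (map ext a)))).
(* [F] vanishes on the columns of [s] and of [t], so only the terms of [x], [y] and [z] survive. *)
rewrite (@big_cat_nat _ _ _ m) ?leq_addr //= big_nat big1 ?add0r; last first.
  move=> j /andP[_ ltj]; rewrite (nth_map (fun=> 0)) ?sza; last by rewrite /p; lia.
  by rewrite /ext eqxx /a nth_cat ltj Fs // mulr0 mul0r.
rewrite (@big_cat_nat _ _ _ (m + 3)) ?leq_add2l ?leq_addr //= addrC.
rewrite [X in X + _]big_nat big1 ?add0r; last first.
  move=> j /andP[lej ltj]; rewrite (nth_map (fun=> 0)) ?sza; last by rewrite /p; lia.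
  rewrite /ext eqxx /a nth_cat ltnNge (leq_trans _ lej) ?leq_addr //=.
  have -> : (j - m = (j - (m + 3)).+3)%N by lia.
  by rewrite /= Ft ?mulr0 ?mul0r //; lia.
have term i l1 l2 v : a = l1 ++ v :: l2 -> i = size l1 ->
    (-1) ^+ (p.+2 + i) * nth (fun=> 0) (map ext a) i p.+2 *
      cdet (take i (map ext a) ++ drop i.+1 (map ext a)) =
    (-1) ^+ (p + i) * F v * cdet (l1 ++ l2).
  move=> def_a def_i; have := sza; rewrite def_a size_cat /= addnS => -[szl].
  rewrite map_cat /= take_size_cat ?size_map // drop_cat size_map ltnNge def_i.
  rewrite leqnSn subSnn /= drop0 -map_cat ext_cdet ?size_cat //.
  by rewrite nth_cat size_map ltnn subnn /= /ext eqxx !exprS mulrA mulrNN !mul1r.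
rewrite big_ltn ?(big_ltn (m := m.+1)) ?(big_ltn (m := m.+2)); try lia.
rewrite big_geq ?addr0; last lia.
rewrite (term m s [:: y, z & t] x) // (term m.+1 (rcons s x) (z :: t) y) ?size_rcons ?cat_rcons //.
rewrite (term m.+2 (rcons (rcons s x) y) t z) ?size_rcons ?cat_rcons // /F.
rewrite !addnS !exprS; have : (-1) ^+ (p + m) != 0 :> R by rewrite signr_eq0.
move: (_ ^+ _) => e e0 sum0; apply: (mulfI e0); apply/eqP; rewrite -subr_eq0.
by rewrite -oppr_eq0 -[X in _ == X]sum0; apply/eqP; ring.
Qed.

End ColumnDeterminants.

(** * Flag minors and column operations *)

(** Column sets are handled as increasing lists, which can be split around the column that an
    operation changes. *)
Definition colseq N s := sorted ltn s && all (gtn N) s.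

Lemma colseq_uniq N s : colseq N s -> uniq s.
Proof. by case/andP=> /(sorted_uniq ltn_trans ltnn). Qed.

Lemma colseq_lt N s c : colseq N s -> c \in s -> (c < N)%N.
Proof. by case/andP=> _ /allP/[apply]. Qed.

Lemma colseq_size N s : colseq N s -> (size s <= N)%N.
Proof.
move=> ss; rewrite -(size_iota 0 N); apply: uniq_leq_size (colseq_uniq ss) _.
by move=> c /(colseq_lt ss); rewrite mem_iota.
Qed.

Lemma colseq_subseq N s t : subseq s t -> colseq N t -> colseq N s.
Proof.
move=> st /andP[sort_t /allP lt_t]; rewrite /colseq (subseq_sorted ltn_trans st) //=.
by apply/allP=> c /(mem_subseq st)/lt_t.
Qed.

Lemma colseq_iota N k : (k <= N)%N -> colseq N (iota 0 k).
Proof.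
move=> kN; rewrite /colseq iota_ltn_sorted; apply/allP=> c.
by rewrite mem_iota add0n /= => /leq_trans; apply.
Qed.

Lemma nth_eqF (j l : nat) s : j \notin s -> (l < size s)%N -> (nth 0%N s l == j) = false.
Proof. by move=> js ls; apply: contraNF js => /eqP <-; apply: mem_nth. Qed.

Section RowMinors.
Variables (R : fieldType) (n : nat).
Implicit Types (M L : 'M[R]_n.+1) (s t : seq nat).

(* Out-of-range indices are sent to [0] by [inord]; [colseq] excludes them. *)
Definition mcol M (c : nat) (i : nat) : R := M (inord i) (inord c).
Definition pminor M s : R := cdet (map (mcol M) s).

Lemma pminorE M s k : size s = k -> pminor M s =
  \det (\matrix_(i < k, j < k) M (inord i) (inord (nth 0%N s j))).
Proof.
move=> szs; rewrite /pminor (@cdetE _ k) ?size_map //; congr (\det _).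
by apply/matrixP=> i j; rewrite !mxE (nth_map 0%N) ?szs.
Qed.

Lemma pminor_nil M : pminor M [::] = 1.
Proof. by rewrite (@pminorE _ _ 0) // det_mx00. Qed.

Lemma pminor_full M : pminor M (iota 0 n.+1) = \det M.
Proof.
rewrite (@pminorE _ _ n.+1) ?size_iota //; congr (\det _).
by apply/matrixP=> i j; rewrite mxE nth_iota // add0n !inord_val.
Qed.

Lemma pminor_dup M s : ~~ uniq s -> pminor M s = 0.
Proof.
case/(uniqPn 0%N)=> i [j [ij js eq_ij]]; rewrite (pminorE M erefl) -det_tr.
apply: (@determinant_alternate _ _ _ (Ordinal (ltn_trans ij js)) (Ordinal js)).
  by rewrite -val_eqE /= neq_ltn ij.
by move=> k; rewrite !mxE /= eq_ij.
Qed.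

Lemma pminor_three_term M s t x y z :
  pminor M (s ++ y :: t) * pminor M (s ++ x :: z :: t) =
  pminor M (s ++ x :: t) * pminor M (s ++ y :: z :: t) +
  pminor M (s ++ z :: t) * pminor M (s ++ x :: y :: t).
Proof. by rewrite /pminor !map_cat /= cdet_three_term. Qed.

Lemma pminor_eq0_succ M k :
  (forall s, colseq n.+1 s -> size s = k -> pminor M s = 0) ->
  forall s, colseq n.+1 s -> size s = k.+1 -> pminor M s = 0.
Proof.
move=> P0 s ss szs; rewrite /pminor (@cdet_expand_last _ k) ?size_map //.
apply: big1 => j _; rewrite -map_take -map_drop -map_cat [cdet _]P0 ?mulr0 //.
  apply: colseq_subseq ss; rewrite -[X in subseq _ X](cat_take_drop j s).
  by rewrite cat_subseq // [drop j s](drop_nth 0%N) ?szs // subseq_cons.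
rewrite size_cat size_take size_drop szs ltn_ord.
by have := ltn_ord j; lia.
Qed.

(** If all minors of size [k] vanished, expansion along the last row would make all larger ones
    vanish, up to the determinant of [M]. *)
Lemma pminor_neq0 M k : M \in unitmx -> (k <= n.+1)%N ->
  exists s, [/\ colseq n.+1 s, size s = k & pminor M s != 0].
Proof.
move=> uM kn; apply: contrapT => noP.
have P0 s : colseq n.+1 s -> size s = k -> pminor M s = 0.
  by move=> ss szs; apply/eqP; apply: contraT => Ps; case: noP; exists s.
have {P0} : forall s, colseq n.+1 s -> size s = (k + (n.+1 - k))%N -> pminor M s = 0.
  elim: (_ - _)%N => [|d IHd] s; first by rewrite addn0; apply: P0.
  by rewrite addnS; apply: pminor_eq0_succ s.
rewrite subnKC // => /(_ _ (colseq_iota (leqnn _)) (size_iota _ _)).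
by move: uM; rewrite pminor_full unitmxE unitfE => /eqP.
Qed.

(** For [j = i.+1] this is right multiplication by [xk j a], the move of the elimination; the
    perturbation also uses [i = j.+1]. *)
Definition addcol M (i j : nat) (a : R) := M *m (1%:M + a *: delta_mx (inord i) (inord j)).

Lemma mcol_addcol M i j a c : (j < n.+1)%N -> (c < n.+1)%N ->
  mcol (addcol M i j a) c =1 fun k => mcol M c k + (c == j)%:R * a * mcol M i k.
Proof.
move=> jn cn k; rewrite /mcol /addcol mulmxDr mulmx1 mxE; congr (_ + _).
rewrite -scalemxAr mxE; rewrite [in LHS]mxE (bigD1 (inord i)) //= big1 => [|l ne].
  rewrite mxE eqxx /= addr0 -val_eqE /= !inordK //; ring.
by rewrite mxE (negPf ne) mulr0.
Qed.

Lemma pminor_addcol_notin M i j a s : (j < n.+1)%N -> colseq n.+1 s ->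
  j \notin s -> pminor (addcol M i j a) s = pminor M s.
Proof.
move=> jn ss js; rewrite /pminor; apply: eq_cdet => [|k l]; rewrite ?size_map // => _ ls.
rewrite !(nth_map 0%N) // mcol_addcol // ?(colseq_lt ss) ?mem_nth //.
by rewrite (nth_eqF js) // !mul0r addr0.
Qed.

(** Linearity in column [j]. The list [s ++ i :: t] need not be increasing; if it repeats [i], its
    minor is 0 by [pminor_dup]. *)
Lemma pminor_addcol_in M i j a s t : colseq n.+1 (s ++ j :: t) ->
  pminor (addcol M i j a) (s ++ j :: t) =
  pminor M (s ++ j :: t) + a * pminor M (s ++ i :: t).
Proof.
move=> ss; have jn : (j < n.+1)%N by rewrite (colseq_lt ss) // mem_cat mem_head orbT.
have := colseq_uniq ss; rewrite cat_uniq /= negb_or => /and3P[_ /andP[js _] /andP[jt _]].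
rewrite /pminor !map_cat /=.
have [w lin] := cdet_linear (map (mcol M) s) (map (mcol M) t).
transitivity (cdet (map (mcol M) s ++ mcol (addcol M i j a) j :: map (mcol M) t)).
  apply: eq_cdet => [|k l]; rewrite !size_cat /= !size_map // => _ ls.
  rewrite !nth_cat !size_map; case: ltnP => lts.
    rewrite !(nth_map 0%N) // mcol_addcol // ?(colseq_lt ss) ?mem_cat ?mem_nth //.
    by rewrite (nth_eqF js) // !mul0r addr0.
  case def_m: (_ - _)%N => [|m] //=; have ltm : (m < size t)%N by lia.
  rewrite !(nth_map 0%N) // mcol_addcol // ?(colseq_lt ss) ?mem_cat ?in_cons ?mem_nth ?orbT //.
  by rewrite (nth_eqF jt) // !mul0r addr0.
rewrite !lin mulr_sumr -big_split; apply: eq_bigr => k _ /=.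
by rewrite mcol_addcol // eqxx mul1r mulrDr mulrCA.
Qed.

Lemma addcolK M i j a : i != j -> (i < n.+1)%N -> (j < n.+1)%N ->
  addcol (addcol M i j (- a)) i j a = M.
Proof.
move=> ne lti ltj; rewrite /addcol -mulmxA mulmxDr mulmx1 mulmxDl mul1mx.
rewrite -scalemxAl -scalemxAr mul_delta_mx_0 ?scaler0 ?addr0.
  by rewrite scaleNr addrNK mulmx1.
by rewrite -val_eqE /= !inordK // eq_sym.
Qed.

Definition lower_scale L k := \prod_(i < k) L (inord i) (inord i).

(** The first rows of [L *m M] involve only equally many first rows of [M], so the submatrix is a
    product of two square ones; [lower_scale] is the leading principal minor of [L]. *)
Lemma pminor_lower L M s : (forall i j : 'I_n.+1, (i < j)%N -> L i j = 0) ->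
  (size s <= n.+1)%N -> pminor (L *m M) s = lower_scale L (size s) * pminor M s.
Proof.
move=> L0 sn; rewrite !(@pminorE _ _ (size s)) //.
set A := \matrix_(_, _) M _ _.
pose T := \matrix_(i < size s, j < size s) L (inord i) (inord j).
have -> : lower_scale L (size s) = \det T.
  rewrite det_trig; first by apply: eq_bigr => i _; rewrite mxE.
  apply/is_trig_mxP => i j ij; rewrite mxE L0 // !inordK //; exact: leq_trans (ltn_ord _) sn.
rewrite -det_mulmx; congr (\det _); apply/matrixP => i j; rewrite !mxE.
have ltin : (i < n.+1)%N by apply: leq_trans (ltn_ord i) sn.
rewrite (bigID (fun l : 'I_n.+1 => (l < size s)%N)) /= addrC big1 ?add0r.
  rewrite (big_ord_narrow sn); apply: eq_bigr => l _; rewrite !mxE.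
  by rewrite -[widen_ord _ _]inord_val.
move=> l; rewrite -leqNgt => le_l.
by rewrite L0 ?mul0r // inordK // (leq_trans (ltn_ord i)).
Qed.

End RowMinors.

(** * Words and braid moves *)

Lemma iota_rcons a k : iota a k.+1 = rcons (iota a k) (a + k)%N.
Proof. by rewrite -addn1 iotaD cats1. Qed.

Section Words.
Variables (R : realType) (n : nat).
Implicit Types (M L U : 'M[R]_n.+1) (u v w : seq nat).

Lemma xkE k a : (0 < k < n.+1)%N ->
  xk n.+1 k a = (1%:M : 'M[R]_n.+1) + a *: delta_mx (inord k.-1) (inord k).
Proof.
case/andP=> k0 kn; apply/matrixP=> i j; rewrite !mxE -!val_eqE /=.
rewrite !inordK ?(leq_ltn_trans (leq_pred k) kn) //.
by case: (_ && _); rewrite ?mulr1 ?mulr0.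
Qed.

Definition in_word w U :=
  exists a : seq R, [/\ size a = size w, forall b, b \in a -> 0 < b & U = xprod n.+1 w a].

Lemma xprod_cat u v a b : size a = size u ->
  xprod n.+1 (u ++ v) (a ++ b) = xprod n.+1 u a *m xprod n.+1 v b :> 'M[R]__.
Proof.
elim: u a => [|k u IHu] [|x a] //=; first by rewrite mul1mx.
by case=> /IHu ->; rewrite mulmxA.
Qed.

Lemma in_word_cat u v U : in_word (u ++ v) U <->
  exists U1 U2, [/\ in_word u U1, in_word v U2 & U = U1 *m U2].
Proof.
split=> [[a [sza apos ->]]|[_ [_ [[a [sza apos ->]] [b [szb bpos ->]] ->]]]].
  have szt : size (take (size u) a) = size u.
    by rewrite size_take sza size_cat; case: ltnP => //; lia.
  exists (xprod n.+1 u (take (size u) a)), (xprod n.+1 v (drop (size u) a)).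
  split; last by rewrite -xprod_cat // cat_take_drop.
    by exists (take (size u) a); split=> // b /mem_take/apos.
  exists (drop (size u) a); split=> // [|b /mem_drop/apos //].
  by rewrite size_drop sza size_cat addKn.
exists (a ++ b); rewrite !size_cat sza szb xprod_cat //; split=> // x.
by rewrite mem_cat => /orP[/apos|/bpos].
Qed.

Lemma in_word_nil : in_word [::] 1%:M.
Proof. by exists [::]. Qed.

Lemma in_word1 k a : 0 < a -> in_word [:: k] (xk n.+1 k a).
Proof.
move=> a0; exists [:: a]; split=> //= [b|]; first by rewrite inE => /eqP ->.
by rewrite mulmx1.
Qed.

(** Despite the name, this compares the sets of positive products along two words, not their
    letters. *)
Definition subword u v := forall U, in_word u U -> in_word v U.

Lemma subword_trans v u w : subword u v -> subword v w -> subword u w.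
Proof. by move=> uv vw U /uv/vw. Qed.

Lemma subword_cat u1 u2 v1 v2 :
  subword u1 v1 -> subword u2 v2 -> subword (u1 ++ u2) (v1 ++ v2).
Proof.
move=> s1 s2 U /in_word_cat[U1 [U2 [/s1 i1 /s2 i2 ->]]].
by apply/in_word_cat; exists U1, U2.
Qed.

Lemma xk_mul i j (a b : R) : (0 < i < n.+1)%N -> (0 < j < n.+1)%N ->
  xk n.+1 i a *m xk n.+1 j b = 1%:M + a *: delta_mx (inord i.-1) (inord i)
    + b *: delta_mx (inord j.-1) (inord j)
    + (if i == j.-1 then (a * b) *: delta_mx (inord i.-1) (inord j) else 0) :> 'M_n.+1.
Proof.
move=> iP jP; rewrite !xkE // mulmxDl mul1mx mulmxDr mulmx1 -!addrA; congr (_ + _).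
rewrite addrCA; congr (_ + (_ + _)).
rewrite -scalemxAl -scalemxAr scalerA mul_delta_mx_cond -val_eqE /= !inordK; try lia.
by case: eqP => _; rewrite ?mulr1n ?mulr0n ?scaler0.
Qed.

Lemma subword_comm i j : (0 < i < n.+1)%N -> (0 < j < n.+1)%N ->
  (i.+1 < j)%N || (j.+1 < i)%N -> subword [:: j; i] [:: i; j].
Proof.
move=> iP jP ij _ [w [szw pos ->]]; case: w szw pos => [|a [|b []]] //= _ pos; rewrite mulmx1.
exists [:: b; a]; split=> //=; first by move=> c ci; apply: pos; rewrite !inE orbC in ci *.
rewrite mulmx1 !xk_mul; try lia.
have [-> ->] : (j == i.-1) = false /\ (i == j.-1) = false by lia.
by rewrite !addr0 addrAC.
Qed.

Lemma subword_braid i : (0 < i)%N -> (i.+1 < n.+1)%N ->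
  subword [:: i.+1; i; i.+1] [:: i; i.+1; i].
Proof.
move=> i0 ltin _ [w [szw pos ->]]; case: w szw pos => [|a [|b [|c []]]] //= _ pos; rewrite mulmx1.
have [a0 b0 c0] : [/\ 0 < a, 0 < b & 0 < c] by rewrite !pos // !inE eqxx ?orbT.
have ac0 : 0 < a + c by apply: addr_gt0.
(* Forced by comparing the entries above the diagonal, which are [b], [a + c] and [b * c]. The
   formulas are free of subtraction, so positivity survives. *)
exists [:: b * c / (a + c); a + c; a * b / (a + c)]; split=> //=.
  by move=> d; rewrite !inE => /or3P[] /eqP -> //; rewrite divr_gt0 ?mulr_gt0.
rewrite mulmx1 !xk_mul ?xkE; try lia.
rewrite eqxx (_ : (i.+1 == i.-1) = false); last lia.
rewrite !mulmxDl !mulmxDr !mul1mx !mulmx1 addr0 -!scalemxAl -!scalemxAr.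
rewrite !mul_delta_mx_cond -!val_eqE /= !inordK; try lia.
have [-> ->] : (i == i.-1) = false /\ (i.+1 == i.-1) = false by lia.
have -> : (i.+1 == i) = false by lia.
rewrite !eqxx ?mulr1n ?mulr0n ?mulmx0 ?scaler0 ?addr0.
move: (delta_mx _ _) (delta_mx _ _) (delta_mx _ _) => e f g.
by apply/matrixP => k l; rewrite !mxE; field; rewrite gt_eqF.
Qed.

Lemma subword_comm_seq j w : (j < n.+1)%N ->
  (forall i, i \in w -> (0 < i)%N && (i.+1 < j)%N) ->
  subword (j :: w) (rcons w j) /\ subword (rcons w j) (j :: w).
Proof.
move=> jn; elim: w => [|i w IHw] far; first by split.
have {IHw} [|up dn] := IHw; first by move=> k kw; apply: far; rewrite in_cons kw orbT.
have fi := far i (mem_head _ _).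
split; rewrite rcons_cons.
  apply: subword_trans (_ : subword ([:: i; j] ++ w) _).
    by apply: (@subword_cat [:: j; i]) => //; apply: subword_comm; lia.
  exact: (@subword_cat [:: i] _ [:: i]).
apply: subword_trans (_ : subword ([:: i; j] ++ w) _).
  exact: (@subword_cat [:: i] _ [:: i]).
by apply: (@subword_cat [:: i; j] _ [:: j; i]) => //; apply: subword_comm; lia.
Qed.

(** The palindromes [a+k .. a .. a+k] and [a .. a+k .. a] are reduced words of the same
    transposition. Induction rewrites the inner palindrome; the two outer letters [c.+1] then
    commute inwards to meet [c], and one braid move finishes. *)
Lemma subword_dn_up a k : (0 < a)%N -> (a + k < n.+1)%N ->
  subword (rev (iota a.+1 k) ++ iota a k.+1) (iota a k ++ rev (iota a k.+1)).
Proof.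
elim: k => [|k IHk] a0 akn //.
set c := (a + k)%N.
have -> : rev (iota a.+1 k.+1) ++ iota a k.+2 =
    [:: c.+1] ++ (rev (iota a.+1 k) ++ iota a k.+1) ++ [:: c.+1].
  by rewrite (iota_rcons a.+1) rev_rcons (iota_rcons a k.+1) -cats1 !catA addnS.
have -> : iota a k.+1 ++ rev (iota a k.+2) =
    iota a k ++ [:: c; c.+1; c] ++ rev (iota a k).
  by rewrite (iota_rcons a k.+1) rev_rcons (iota_rcons a k) rev_rcons cat_rcons addnS.
apply: subword_trans (_ : subword ([:: c.+1] ++ (iota a k ++ rev (iota a k.+1)) ++ [:: c.+1]) _).
  by apply: subword_cat => //; apply: subword_cat => //; apply: IHk => //; lia.
apply: subword_trans (_ : subword (rcons (iota a k) c.+1 ++ [:: c] ++ (c.+1 :: rev (iota a k))) _).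
  rewrite (_ : _ ++ _ = (c.+1 :: iota a k) ++ [:: c] ++ rcons (rev (iota a k)) c.+1); last first.
    by rewrite (iota_rcons a k) rev_rcons -catA /= cats1.
  apply: subword_cat.
    by apply: (subword_comm_seq _ _).1 => [|i]; rewrite ?mem_iota; lia.
  apply: (@subword_cat [:: c] _ [:: c]) => //.
  by apply: (subword_comm_seq _ _).2 => [|i]; rewrite ?mem_rev ?mem_iota; lia.
rewrite cat_rcons; apply: subword_cat => //.
apply: (@subword_cat [:: c.+1; c; c.+1] _ [:: c; c.+1; c]) => //.
by apply: subword_braid; lia.
Qed.

(** The word [(a+l-1) (a+l-2 a+l-1) ... (a ... a+l-1)], in the order in which the elimination yields
    its factors. *)
Fixpoint up_word a l := if l is l'.+1 then up_word a.+1 l' ++ iota a l else [::].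
(** [dn_word 1 n] is [w0_word n.+1]. *)
Definition dn_word a l := flatten [seq rev (iota a j) | j <- iota 1 l].

Lemma dn_wordS a l : dn_word a l.+1 = dn_word a l ++ rev (iota a l.+1).
Proof. by rewrite /dn_word iota_rcons map_rcons -cats1 flatten_cat /= cats0. Qed.

(** The ascending run travels left through the descending blocks. By [subword_dn_up] each passage
    appends the letter [a] to a block and takes the last letter off the run. *)
Lemma subword_dn_word a l : (0 < a)%N -> (a + l < n.+1)%N ->
  subword (dn_word a.+1 l ++ iota a l.+1) (dn_word a l.+1).
Proof.
elim: l => [|l IHl] a0 aln //; rewrite dn_wordS [X in subword _ X]dn_wordS -catA.
apply: subword_trans (_ : subword (dn_word a.+1 l ++ (iota a l.+1 ++ rev (iota a l.+2))) _).
  by apply: subword_cat => //; apply: subword_dn_up.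
by rewrite catA; apply: subword_cat => //; apply: IHl => //; lia.
Qed.

Lemma subword_up_dn a l : (0 < a)%N -> (a + l <= n.+1)%N ->
  subword (up_word a l) (dn_word a l).
Proof.
elim: l a => [|l IHl] a a0 aln //=.
apply: subword_trans (_ : subword (dn_word a.+1 l ++ iota a l.+1) _).
  by apply: subword_cat => //; apply: IHl => //; lia.
by apply: subword_dn_word => //; lia.
Qed.

End Words.

(** * Elimination of a flag with positive minors *)

Lemma colseq_insert_pred N s t c :
  colseq N (s ++ c.+1 :: t) -> c \notin s -> colseq N (s ++ c :: c.+1 :: t).
Proof.
rewrite /colseq !(sorted_pairwise ltn_trans) !pairwise_cat /= !all_cat /=.
case/andP=> /and3P[]; rewrite !allrel_consr => /andP[s_c s_t] ps /andP[c_t pt].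
case/and3P=> sN cN tN cs; rewrite s_c s_t ps c_t pt sN cN tN ltnSn (ltnW cN) !andbT /=.
apply/andP; split; apply/allP => x.
  move=> xs; rewrite ltn_neqAle -ltnS (allP s_c) // andbT.
  by apply: contraNneq cs => <-.
by move=> xt; apply: ltnW; apply: (allP c_t).
Qed.

Lemma colseq_cat_lt N s t x y :
  colseq N (s ++ t) -> x \in s -> y \in t -> (x < y)%N.
Proof.
case/andP; rewrite (sorted_pairwise ltn_trans) pairwise_cat => /and3P[/allrelP st _ _] _.
exact: st.
Qed.

Section Neville.
Variables (R : realType) (n : nat).
Implicit Types (M L U : 'M[R]_n.+1) (s t u : seq nat).

(* State of the elimination of row [r], cleared so far beyond column [c]: a minor
   on the columns [0 .. r-1, x, ...] is positive if [x <= c] and zero otherwise. *)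
Definition neville r c M := [/\
  forall i j : 'I_n.+1, (i < r)%N -> (i < j)%N -> M i j = 0,
  forall x u, colseq n.+1 (iota 0 r ++ x :: u) -> (x <= c)%N ->
    0 < pminor M (iota 0 r ++ x :: u)
& forall x u, colseq n.+1 (iota 0 r ++ x :: u) -> (c < x)%N ->
    pminor M (iota 0 r ++ x :: u) = 0].

Lemma neville_gt0 r c M u y : neville r c M ->
  colseq n.+1 (iota 0 r ++ u) -> y \in u -> (y <= c)%N ->
  0 < pminor M (iota 0 r ++ u).
Proof.
case=> _ pos _; case: u => // x u ss; rewrite in_cons => yu yc; apply: pos => //.
case/predU1P: yu => [<- //|yu]; apply: leq_trans yc; apply: ltnW.
move: ss; rewrite /colseq (sorted_pairwise ltn_trans) pairwise_cat /=.
by case/andP=> /and4P[_ _ /allP/(_ _ yu)].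
Qed.

Lemma notin_iota r c : (r <= c)%N -> c \notin iota 0 r.
Proof. by move=> rc; rewrite mem_iota -leqNgt. Qed.

Section Step.
Variables (r c : nat) (M : 'M[R]_n.+1).
Hypotheses (rc : (r <= c)%N) (cn : (c < n)%N) (nevM : neville r c.+1 M).

(** Since the first [r] rows are lower triangular, this is the ratio of the entries of row [r] in
    columns [c.+1] and [c], the multiplier that clears the former. *)
Definition pivot := pminor M (iota 0 r ++ [:: c.+1]) / pminor M (iota 0 r ++ [:: c]).

Let colseq_rc : colseq n.+1 (iota 0 r ++ [:: c; c.+1]).
Proof.
apply: colseq_insert_pred; last exact: notin_iota.
apply: colseq_subseq (colseq_iota (leqnn n.+1)).
have -> : n.+1 = (r + ((c.+1 - r) + (n - c)))%N by lia.
rewrite iotaD cat_subseq // sub1seq mem_iota; lia.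
Qed.

Lemma pivot_gt0 : 0 < pivot.
Proof.
rewrite divr_gt0 //; apply: (neville_gt0 nevM _ (mem_head _ _)); rewrite ?leqnSn //;
  by apply: colseq_subseq colseq_rc; rewrite cat_subseq // sub1seq !inE eqxx ?orbT.
Qed.

(** Induction on the list: in the three-term relation for [c], [c.+1] and the next column [x], the
    minor that continues with [x] right after [iota 0 r] is already zero, and the two remaining
    products agree. *)
Lemma pivot_eq u : colseq n.+1 (iota 0 r ++ c.+1 :: u) ->
  pminor M (iota 0 r ++ c.+1 :: u) = pivot * pminor M (iota 0 r ++ c :: u).
Proof.
have cr := notin_iota rc.
elim: u => [|x u IHu] ss.
  rewrite /pivot divfK // gt_eqF //; apply: (neville_gt0 nevM _ (mem_head _ _)) => //.
  by apply: colseq_subseq colseq_rc; rewrite cat_subseq // sub1seq mem_head.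
have su : colseq n.+1 (iota 0 r ++ c.+1 :: u).
  apply: colseq_subseq ss; apply: cat_subseq => //.
  by apply: (@cat_subseq _ [:: c.+1] u [:: c.+1]) => //; apply: subseq_cons.
have sx : colseq n.+1 (iota 0 r ++ x :: u).
  by apply: colseq_subseq ss; rewrite cat_subseq // subseq_cons.
have scu : 0 < pminor M (iota 0 r ++ c :: u).
  apply: (neville_gt0 nevM _ (mem_head _ _)) => //.
  apply: colseq_subseq (colseq_insert_pred su cr).
  by apply: cat_subseq => //; apply: (@cat_subseq _ [:: c] u [:: c]) => //; apply: subseq_cons.
have cx : (c.+1 < x)%N.
  case/andP: ss; rewrite (sorted_pairwise ltn_trans) pairwise_cat /=.
  by move=> /and3P[_ _ /andP[/andP[]]].
have [_ _ /(_ _ _ sx cx) zx] := nevM.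
have := pminor_three_term M (iota 0 r) u c c.+1 x.
rewrite zx mul0r addr0 IHu // -mulrA mulrCA => e.
apply: (mulfI (lt0r_neq0 scu)); rewrite -e; ring.
Qed.

(** This keeps minors positive when [pivot] times column [c] is subtracted. Induction on the last
    element [x] of [u]: the three-term relation for [x], [c], [c.+1] transports the inequality, and
    its extra positive term makes it strict. For empty [u], [pivot_eq] gives equality. *)
Lemma pivot_le u t : colseq n.+1 (iota 0 r ++ u ++ c.+1 :: t) -> c \notin u ->
  pivot * pminor M (iota 0 r ++ u ++ c :: t) <= pminor M (iota 0 r ++ u ++ c.+1 :: t)
    ?= iff (u == [::]).
Proof.
elim/last_ind: u => [|u x IHu] ss; first by rewrite -pivot_eq //; apply/leif_refl.
rewrite mem_rcons inE negb_or => /andP[ne_cx cu].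
have su : colseq n.+1 (iota 0 r ++ u ++ c.+1 :: t).
  by apply: colseq_subseq ss; rewrite cat_subseq // cat_subseq ?subseq_rcons.
have cr := notin_iota rc; have x_lt : (x <= c)%N.
  rewrite -ltnS; apply: (@colseq_cat_lt n.+1 (iota 0 r ++ rcons u x) (c.+1 :: t)).
  - by rewrite -catA.
  - by rewrite mem_cat mem_rcons mem_head orbT.
  - exact: mem_head.
have ss' : colseq n.+1 (iota 0 r ++ rcons u x ++ c :: c.+1 :: t).
  rewrite catA; apply: colseq_insert_pred; first by rewrite -catA.
  by rewrite mem_cat mem_rcons inE !negb_or cr ne_cx.
have [c_t c_sub] : subseq (c :: t) (c :: c.+1 :: t) /\ subseq t (c :: c.+1 :: t).
  have t_sub := subseq_cons t c.+1.
  split; first exact: (@cat_subseq _ [:: c] t [:: c]).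
  exact: subseq_trans t_sub (subseq_cons _ _).
have pos v y : subseq v (rcons u x ++ c :: c.+1 :: t) -> y \in v -> (y <= c)%N ->
    0 < pminor M (iota 0 r ++ v).
  move=> vs yv yc; apply: (neville_gt0 nevM _ yv); last exact: leqW.
  by apply: colseq_subseq ss'; apply: cat_subseq.
have p1 : 0 < pminor M (iota 0 r ++ u ++ c :: t).
  by apply: (pos _ c); rewrite ?mem_cat ?mem_head ?orbT //; apply: cat_subseq (subseq_rcons _ _) _.
have p2 : 0 < pminor M (iota 0 r ++ u ++ x :: t).
  rewrite -cat_rcons; apply: (pos _ x); rewrite ?mem_cat ?mem_rcons ?mem_head //.
  exact: cat_subseq.
have p3 : 0 < pminor M (iota 0 r ++ u ++ c :: c.+1 :: t).
  by apply: (pos _ c); rewrite ?mem_cat ?mem_head ?orbT //; apply: cat_subseq (subseq_rcons _ _) _.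
have p4 : 0 < pminor M (iota 0 r ++ u ++ x :: c :: t).
  rewrite -cat_rcons; apply: (pos _ x); rewrite ?mem_cat ?mem_rcons ?mem_head //.
  exact: cat_subseq.
have := pminor_three_term M (iota 0 r ++ u) t x c c.+1; rewrite -!catA.
have [le_u _] := IHu su cu => e.
rewrite !cat_rcons; have -> : (rcons u x == [::]) = false by case: (u).
have lt : pivot * pminor M (iota 0 r ++ u ++ x :: c :: t)
    < pminor M (iota 0 r ++ u ++ x :: c.+1 :: t).
  rewrite -(ltr_pM2l p1) e mulrCA mulrA; apply: (@le_lt_trans _ _
    (pminor M (iota 0 r ++ u ++ c.+1 :: t) * pminor M (iota 0 r ++ u ++ x :: c :: t))).
    by rewrite ler_pM2r.
  by rewrite ltrDr mulr_gt0.
by split; [exact: ltW | exact: lt_eqF].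
Qed.

Lemma neville_step : neville r c (addcol M c c.+1 (- pivot)).
Proof.
have [tri pos zero] := nevM; have cr := notin_iota rc.
split.
- move=> i j ir ij.
  have := mcol_addcol M c (j := c.+1) (- pivot) cn (ltn_ord j) i.
  rewrite /mcol !inord_val => ->; rewrite tri // [X in _ * X]tri ?mulr0 ?addr0 //.
  by rewrite inordK; lia.
- move=> x u ss xc.
  have [|cu] := boolP (c.+1 \in x :: u); last first.
    rewrite pminor_addcol_notin //; last by rewrite mem_cat negb_or notin_iota // leqW.
    by apply: pos => //; apply: leqW.
  rewrite inE gtn_eqF //= => /path.splitPr def_u; case: def_u ss => u1 u2 ss.
  rewrite -cat_cons catA pminor_addcol_in -?catA //.
  (* If [c] is present, the subtracted minor has a repeated column; otherwise [pivot_le] is strict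
     because [x :: u1] is not empty. *)
  have [cxu|cxu] := boolP (c \in x :: u1).
    rewrite [X in _ * X]pminor_dup ?mulr0 ?addr0; first by apply: pos => //; apply: leqW.
    by rewrite cat_uniq cat_uniq [has _ (c :: _)]/= cxu !andbF.
  have [le ne] := pivot_le (u := x :: u1) ss cxu.
  rewrite mulNr subr_gt0 lt_neqAle le andbT.
  by rewrite ne.
move=> x u ss cx.
have [cu|cu] := boolP (c.+1 \in x :: u); last first.
  rewrite pminor_addcol_notin //; last by rewrite mem_cat negb_or notin_iota // leqW.
  apply: zero => //; rewrite ltn_neqAle cx andbT.
  by apply: contraNneq cu => ->; rewrite mem_head.
(* An increasing list that starts beyond [c] and contains [c.+1] must start with it, and [pivot_eq]
   then gives exact cancellation. *)
have def_x : x = c.+1.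
  apply/eqP; rewrite eqn_leq cx andbT leqNgt; apply/negP => lt_cx.
  suff : (c.+1 < c.+1)%N by rewrite ltnn.
  case/predU1P: cu => [def_c|cu]; first by rewrite {2}def_c.
  apply: leq_trans lt_cx _; apply: ltnW.
  apply: (@colseq_cat_lt n.+1 (rcons (iota 0 r) x) u) => //; first by rewrite cat_rcons.
  by rewrite mem_rcons mem_head.
rewrite def_x in ss *; by rewrite pminor_addcol_in // pivot_eq // mulNr subrr.
Qed.

End Step.

(** Columns are cleared from right to left and each inverse operation is restored on the right, the
    first one outermost; hence the increasing word. *)
Lemma neville_row r d M : (r + d <= n)%N -> neville r (r + d) M ->
  exists M' U, [/\ neville r r M', in_word (iota r.+1 d) U & M = M' *m U].
Proof.
elim: d M => [|d IHd] M rdn nevM.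
  exists M, 1%:M; rewrite addn0 in nevM; split=> //; last by rewrite mulmx1.
  exact: in_word_nil.
rewrite addnS in rdn nevM; have rd := leq_addr d r.
have [|M' [U [nevM' wU eM]]] := IHd _ _ (neville_step rd rdn nevM); first exact: ltnW.
set a := pivot _ _ M in eM.
exists M', (U *m xk n.+1 (r + d).+1 a); split=> //.
  rewrite iota_rcons -cats1; apply/in_word_cat; exists U, (xk n.+1 (r + d).+1 a).
  by split=> //; apply: in_word1; apply: pivot_gt0.
rewrite mulmxA -eM xkE /=; last by lia.
by rewrite -[LHS](@addcolK _ _ M (r + d)%N (r + d).+1 a) //; lia.
Qed.

Lemma pminor_triangular r j M : (r <= j)%N -> (j < n.+1)%N ->
  (forall i k : 'I_n.+1, (i < r)%N -> (i < k)%N -> M i k = 0) ->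
  pminor M (iota 0 r ++ [:: j]) = lower_scale M r * M (inord r) (inord j).
Proof.
move=> rj jn tri; rewrite (@pminorE _ _ _ _ r.+1); last by rewrite size_cat size_iota addn1.
rewrite det_trig.
  rewrite big_ord_recr mxE /= nth_cat size_iota ltnn subnn /=; congr (_ * _).
  apply: eq_bigr => i _; rewrite mxE /= nth_cat size_iota ltn_ord nth_iota //.
apply/is_trig_mxP => i k ik; have := ltn_ord i; have := ltn_ord k => ltk lti.
have ir : (i < r)%N by lia.
have [ik' kn'] : (i < nth 0%N (iota 0 r ++ [:: j]) k < n.+1)%N /\ (k < r.+1)%N.
  rewrite nth_cat size_iota; case: (ltnP k r) => kr; first by rewrite nth_iota //; lia.
  by rewrite (_ : (k - r)%N = 0%N) /=; lia.
by rewrite mxE tri ?inordK //; lia.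
Qed.

(** Up to a nonzero factor the entries of row [r] are minors on [iota 0 r] and one more column, so
    those beyond the diagonal vanish. Lists starting with [iota 0 r.+1] are those with [x = r],
    hence have positive minors. *)
Lemma neville_next_row r M : (r <= n)%N -> neville r r M -> neville r.+1 n M.
Proof.
move=> rn [tri pos zero].
have iotaS u : iota 0 r.+1 ++ u = iota 0 r ++ r :: u by rewrite iota_rcons cat_rcons.
have sj j : (r <= j)%N -> (j < n.+1)%N -> colseq n.+1 (iota 0 r ++ [:: j]).
  move=> rj jn; apply: colseq_subseq (colseq_iota (leqnn n.+1)).
  have -> : n.+1 = (r + (n.+1 - r))%N by lia.
  by rewrite iotaD cat_subseq // sub1seq mem_iota; lia.
split=> [i j ir ij|x u ss xn|x u ss nx].
- have [/tri -> //|ri] := ltnP i r; have {}ir : i = r :> nat by lia.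
  have Mr0 : lower_scale M r != 0.
    have := pos r [::] (sj r (leqnn _) rn) (leqnn _).
    by rewrite pminor_triangular //; apply: contraTneq => ->; rewrite mul0r ltxx.
  have rj : (r < j)%N by rewrite -ir.
  have := zero j [::] (sj j (ltnW rj) (ltn_ord j)) rj.
  rewrite pminor_triangular // 1?ltnW // -ir !inord_val => /eqP.
  by rewrite ir mulf_eq0 (negPf Mr0) => /eqP.
- by rewrite iotaS in ss *; apply: pos.
by have := colseq_lt ss; move/(_ x); rewrite mem_cat mem_head orbT => /(_ isT); lia.
Qed.

Lemma neville_factor l r M : (r + l)%N = n -> neville r n M ->
  exists L U, [/\ lower_inv L, in_word (up_word r.+1 l) U & M = L *m U].
Proof.
elim: l r M => [|l IHl] r M rln nevM.
  rewrite addn0 in rln; subst r.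
  exists M, 1%:M; split; last by rewrite mulmx1.
    split; last by have [tri _ _] := neville_next_row (leqnn n) nevM => i j; apply: tri.
    (* The determinant is itself one of the positive minors, on [iota 0 n] followed by [n]. *)
    rewrite unitmxE unitfE -pminor_full iota_rcons -cats1 gt_eqF //.
    apply: (neville_gt0 nevM _ (mem_head _ _)) => //.
    by rewrite cats1 -iota_rcons colseq_iota.
  exact: in_word_nil.
have := @neville_row r l.+1 M; rewrite rln leqnn => /(_ isT nevM) [M' [U' [nevM' wU' ->]]].
have rn : (r <= n)%N by lia.
have [|L [U [LP wU ->]]] := IHl r.+1 M' _ (neville_next_row rn nevM'); first by lia.
exists L, (U *m U'); split=> //; last by rewrite mulmxA.
by apply/in_word_cat; exists U, U'.
Qed.

Lemma positive_rep_Upos_flag M : (forall s, colseq n.+1 s -> 0 < pminor M s) ->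
  rep_Upos_flag M.
Proof.
move=> posM; have nevM : neville 0 n M.
  split=> [//|x u ss _|x u ss nx]; first exact: posM.
  by have := colseq_lt ss (mem_head _ _); lia.
have [L [U [LP /subword_up_dn wU ->]]] := neville_factor (add0n n) nevM.
exists U; split; last by exists L.
by have [//|//|a [sza apos ->]] := wU; exists a.
Qed.

End Neville.

(** * Perturbation to positive minors *)

(** No index lies strictly between neighbours, so only a repetition of [i] could break the order. *)
Lemma colseq_replace N s t i j : colseq N (s ++ j :: t) -> (i < N)%N ->
  (i.+1 == j) || (j.+1 == i) -> i \notin s -> i \notin t -> colseq N (s ++ i :: t).
Proof.
rewrite /colseq !(sorted_pairwise ltn_trans) !pairwise_cat /= !all_cat /=.
case/andP=> /and3P[]; rewrite !allrel_consr => /andP[s_j s_t] ps /andP[j_t pt].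
case/and3P=> sN jN tN iN adj si ti; rewrite s_t ps pt sN iN tN !andbT /=.
apply/andP; split; apply/allP => x xs.
  have := allP s_j x xs; have : x != i by apply: contraNneq si => <-.
  by move=> /= ne lt; clear -ne lt adj; lia.
have := allP j_t x xs; have : x != i by apply: contraNneq ti => <-.
by move=> /= ne lt; clear -ne lt adj; lia.
Qed.

(** * Moves by adjacent swaps among sets of equal size *)

Section Adjacency.
Variable n : nat.
Implicit Types A B I J : {set 'I_n}.

Definition adjacent (i j : 'I_n) := (i.+1 == j) || (j.+1 == i).

Lemma sum_swap A (i j : 'I_n) : j \in A -> i \notin A -> (i < j)%N ->
  (\sum_(k in i |: A :\ j) k < \sum_(k in A) k)%N.
Proof.
move=> jA iA ij; rewrite (big_setD1 j jA) big_setU1 ?ltn_add2r //=.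
by rewrite !inE (negPf iA) andbF.
Qed.

Lemma card_swap A (i j : 'I_n) : j \in A -> i \notin A -> #|i |: A :\ j| = #|A|.
Proof.
move=> jA iA; rewrite cardsU1 !inE (negPf iA) andbF (cardsD1 j A) jA.
by [].
Qed.

Lemma swapK A (i j : 'I_n) : j \in A -> i \notin A -> j |: (i |: A :\ j) :\ i = A.
Proof.
move=> jA iA; apply/setP => k; rewrite !inE.
have [-> | kj] := eqVneq k j; first by rewrite jA.
by have [-> | ki] := eqVneq k i; rewrite ?(negPf iA) ?andbF.
Qed.

(** Both sets are initial segments, so one contains the other and equal sizes decide. *)
Lemma down_closed_eq A B : #|A| = #|B| ->
  (forall i j : 'I_n, j \in A -> i.+1 = j :> nat -> i \in A) ->
  (forall i j : 'I_n, j \in B -> i.+1 = j :> nat -> i \in B) -> A = B.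
Proof.
have down C : (forall i j : 'I_n, j \in C -> i.+1 = j :> nat -> i \in C) ->
    forall d (i j : 'I_n), j \in C -> (i + d)%N = j -> i \in C.
  move=> dC; elim=> [|d IHd] i j jC; first by rewrite addn0 => /val_inj ->.
  move=> idj; have id_n : (i + d < n)%N by have := ltn_ord j; lia.
  by apply: (IHd i (Ordinal id_n)) => //; apply: (dC _ j) => //=; lia.
move=> cAB /down dA /down dB.
have [sAB | /subsetPn[x xA xB]] := boolP (A \subset B).
  by apply/eqP; rewrite eqEcard sAB cAB leqnn.
apply/esym/eqP; rewrite eqEcard cAB leqnn andbT; apply/subsetP => y yB.
case: (leqP y x) => xy; first by apply: (dA (x - y)%N _ _ xA); rewrite subnKC.
by case/negP: xB; apply: (dB (y - x)%N _ _ yB); rewrite subnKC // ltnW.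
Qed.

(* Otherwise sets of minimal element sum inside and outside [P] would both be
   initial segments of the same size. *)
Lemma adjacent_boundary (P : pred {set 'I_n}) A0 B0 : #|A0| = #|B0| -> P A0 -> ~~ P B0 ->
  exists B i j, [/\ ~~ P B, adjacent i j, j \in B, i \notin B & P (i |: B :\ j)].
Proof.
move=> cAB PA PB; apply: contrapT => noP.
have closed B i j : ~~ P B -> adjacent i j -> j \in B -> i \notin B -> ~~ P (i |: B :\ j).
  by move=> nPB ij jB iB; apply/negP => PS; apply: noP; exists B, i, j.
have [A /andP[/eqP cA PA'] minA] := @arg_minnP _ A0 (fun A => (#|A| == #|A0|) && P A)
  (fun A => \sum_(k in A) k)%N ltac:(by rewrite /= eqxx PA).
have [B /andP[/eqP cB PB'] minB] := @arg_minnP _ B0 (fun A => (#|A| == #|A0|) && ~~ P A)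
  (fun A => \sum_(k in A) k)%N ltac:(by rewrite /= cAB eqxx PB).
suff eAB : A = B by rewrite -eAB PA' in PB'.
apply: down_closed_eq => [|i j jA ij|i j jB ij]; first by rewrite cA cB.
  apply: contraT => iA; have lt_ij : (i < j)%N by rewrite -ij.
  have [PS | PS] := boolP (P (i |: A :\ j)).
    have := minA (i |: A :\ j); rewrite card_swap // cA eqxx PS => /(_ isT).
    by rewrite leqNgt sum_swap.
  (* If the lowered set fails [P], the reverse swap leads from it back to [A] and so crosses the
     boundary. *)
  have := @closed _ j i PS; rewrite swapK // PA'; apply.
  - by rewrite /adjacent ij eqxx orbT.
  - by rewrite !inE eqxx.
  - by rewrite !inE eqxx orbF; apply: contraNneq iA => <-.
apply: contraT => iB; have lt_ij : (i < j)%N by rewrite -ij.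
have := minB (i |: B :\ j); rewrite card_swap // cB eqxx closed // => [/(_ isT)|].
  by rewrite leqNgt sum_swap.
by rewrite /adjacent ij eqxx.
Qed.

End Adjacency.

(** * Pluecker coordinates as minors on increasing lists *)

Section PluckerMinors.
Variables (R : realType) (n : nat).
Implicit Types (M N L U : 'M[R]_n.+1) (I J : {set 'I_n.+1}).

Definition colseq_of I : seq nat := map val (enum I).

Lemma plucker_pminor I M : plucker I M = pminor M (colseq_of I).
Proof.
rewrite /plucker (@pminorE _ _ _ _ #|I|); last by rewrite size_map -cardE.
congr (\det _); apply/matrixP => i j; rewrite !mxE.
rewrite (nth_map (enum_val j)) -?cardE // -enum_val_nth inord_val.
by rewrite -[widen_ord _ _]inord_val.
Qed.

Lemma colseq_ofP I : colseq n.+1 (colseq_of I).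
Proof.
apply: colseq_subseq (colseq_iota (leqnn _)); rewrite -val_enum_ord.
by apply: map_subseq; rewrite [X in subseq _ X]enumT; apply: filter_subseq.
Qed.

Lemma mem_colseq_of I (i : 'I_n.+1) : (val i \in colseq_of I) = (i \in I).
Proof. by rewrite mem_map ?mem_enum //; apply: val_inj. Qed.

Lemma colseq_of_inj s I : colseq n.+1 s ->
  (forall i : 'I_n.+1, (val i \in s) = (i \in I)) -> colseq_of I = s.
Proof.
move=> ss sI; have /andP[sort_I lt_I] := colseq_ofP I; have /andP[sort_s lt_s] := ss.
apply: (irr_sorted_eq ltn_trans ltnn) => // c.
have [cn | nc] := ltnP c n.+1; first by rewrite -[c]/(val (Ordinal cn)) mem_colseq_of sI.
apply/idP/idP => cs; [have := allP lt_I _ cs | have := allP lt_s _ cs];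
  by rewrite /= ltnNge nc.
Qed.

Lemma size_colseq_of I : size (colseq_of I) = #|I|.
Proof. by rewrite size_map -cardE. Qed.

Lemma colseqP s : colseq n.+1 s -> exists I, colseq_of I = s.
Proof.
move=> ss; exists [set i : 'I_n.+1 | val i \in s]; apply: colseq_of_inj => // i.
by rewrite inE.
Qed.

(** Because [i] and [j] are neighbours, putting [i] in the place of [j] keeps the columns in order,
    so no sign appears. *)
Lemma plucker_addcol M I (i j : 'I_n.+1) a : adjacent i j ->
  plucker I (addcol M i j a) = plucker I M +
    (if (j \in I) && (i \notin I) then a * plucker (i |: I :\ j) M else 0).
Proof.
move=> adj; rewrite !plucker_pminor; have ss := colseq_ofP I.
have [jI | jI] /= := boolP (j \in I); last first.
  by rewrite addr0 pminor_addcol_notin // mem_colseq_of.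
have : val j \in colseq_of I by rewrite mem_colseq_of.
have memI := mem_colseq_of I.
move: memI ss; move: (colseq_of I) => s memI ss /path.splitPr sj.
case: sj memI ss => s1 s2 memI ss; rewrite pminor_addcol_in //; congr (_ + _).
have := colseq_uniq ss; rewrite cat_uniq /= negb_or => /and3P[_ /andP[js1 _] /andP[js2 _]].
have ne_ij : i != j by apply: contraTneq adj => ->; rewrite /adjacent gtn_eqF.
have mem12 (k : 'I_n.+1) : k != j -> (val k \in s1 ++ s2) = (k \in I).
  by move=> kj; rewrite -memI !mem_cat in_cons (inj_eq val_inj) (negPf kj).
case: ifP => [iI | /negbFE iI].
  congr (a * pminor M _).
  have [is1 is2] : val i \notin s1 /\ val i \notin s2.
    by apply/andP; rewrite -negb_or -mem_cat mem12.
  apply/esym/colseq_of_inj => [|k].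
    by apply: colseq_replace ss _ adj is1 is2.
  rewrite mem_cat in_cons !inE (inj_eq val_inj) orbCA -mem_cat; congr (_ || _).
  have [-> | kj] := eqVneq k j; last by rewrite mem12.
  by rewrite mem_cat (negPf js1) (negPf js2).
rewrite pminor_dup ?mulr0 //; rewrite -mem12 // mem_cat in iI.
rewrite cat_uniq /=; case/orP: iI => ->; first by rewrite !andbF.
by rewrite !andbF.
Qed.

End PluckerMinors.

Section Perturbation.
Variables (R : realType) (n : nat).
Implicit Types (M N : 'M[R]_n.+1) (I J : {set 'I_n.+1}).

Lemma perturb_positive M e : M \in unitmx -> (forall I, 0 <= plucker I M) -> 0 < e ->
  exists N, [/\ N \in unitmx, forall I, 0 < plucker I N &
                forall i j, `|N i j - M i j| < e].
Proof.
have [m] := ubnP #|[set I | plucker I M == 0]|.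
elim: m M e => // m IHm M e lt_m uM nnM e0.
have [[J /eqP PJ]|pos] := pselect (exists J, plucker J M == 0); last first.
  exists M; split=> // [I|i j]; last by rewrite subrr normr0.
  by rewrite lt_neqAle nnM andbT eq_sym; apply/negP => PI; apply: pos; exists I.
(* Invertibility gives a nonvanishing coordinate of the same size as [J], so the zero pattern has a
   boundary between sets of that size. *)
have [s [ss szs Ps]] := pminor_neq0 uM (colseq_size (colseq_ofP J)).
have [A def_s] := colseqP ss.
have [|||B [i [j [/negbNE/eqP PB adj jB iB PS]]]] :=
    @adjacent_boundary _ (fun I => plucker I M != 0) A J.
- by rewrite -!size_colseq_of def_s.
- by rewrite plucker_pminor def_s.
- by rewrite PJ eqxx.
(* [K] bounds all entries of [M], so adding [a] times a column moves each entry by at most [e / 2];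
   the other half is left to the induction. *)
pose K := 1 + \sum_(p : 'I_n.+1 * 'I_n.+1) `|M p.1 p.2|.
have K0 : 0 < K by rewrite ltr_wpDr // sumr_ge0.
have le_K k l : `|M k l| <= K.
  rewrite /K (bigD1 (k, l)) //= addrCA lerDl addr_ge0 // sumr_ge0 //.
pose a := e / 2 / K; have a0 : 0 < a by rewrite !divr_gt0.
pose M1 := addcol M i j a.
have leP I : plucker I M <= plucker I M1.
  rewrite plucker_addcol // lerDl; case: ifP => // _.
  by rewrite mulr_ge0 // ltW.
(* The determinant is the coordinate of the full set: it is positive for [M] and does not
   decrease. *)
have uM1 : M1 \in unitmx.
  have [I0 def_I0] := colseqP (colseq_iota (leqnn n.+1)).
  move: uM; rewrite !unitmxE !unitfE -!pminor_full -def_I0 -!plucker_pminor.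
  by rewrite !neq_lt !ltNge nnM /= (le_trans _ (leP _)) //= -!ltNge => /lt_le_trans; apply.
have [|||//|N [uN posN distN]] := IHm M1 (e / 2).
- rewrite -ltnS; apply: leq_trans lt_m; rewrite ltnS; apply: proper_card.
  apply/properP; split.
    by apply/subsetP => I; rewrite !inE => /eqP P0; rewrite eq_le nnM andbT -[leRHS]P0 leP.
  exists B; rewrite !inE; first exact/eqP.
  rewrite plucker_addcol // jB iB PB add0r mulf_neq0 //.
  by rewrite gt_eqF.
- exact: uM1.
- by move=> I; apply: le_trans (nnM I) (leP I).
- by rewrite divr_gt0.
exists N; split=> // k l.
rewrite -[N k l](subrK (M1 k l)) -addrA (le_lt_trans (ler_normD _ _)) //.
rewrite [ltRHS](splitr e) ltr_leD //.
have := mcol_addcol M i a (ltn_ord j) (ltn_ord l) k.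
rewrite /mcol !inord_val -/M1 => ->; rewrite addrAC subrr add0r.
case: (_ == _); rewrite ?mul1r ?mul0r ?normr0; last by rewrite divr_ge0 ?ltW.
rewrite normrM gtr0_norm // /a mulrAC ler_pdivrMr // ler_pM2l ?divr_gt0 //.
Qed.

End Perturbation.

(** * The closure *)

Section Continuity.
Variables (R : realType) (n : nat) (M : 'M[R]_n).
Implicit Types f g : 'M[R]_n -> R.

Definition mx_continuous f := forall e : R, 0 < e -> exists2 d : R, 0 < d &
  forall N : 'M[R]_n, (forall i j, `|N i j - M i j| < d) -> `|f N - f M| < e.

Lemma mx_continuous_cst a : mx_continuous (fun=> a).
Proof. by move=> e e0; exists 1 => // N _; rewrite subrr normr0. Qed.

Lemma mx_continuous_coef i j : mx_continuous (fun N => N i j).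
Proof. by move=> e e0; exists e. Qed.

Lemma mx_continuousD f g :
  mx_continuous f -> mx_continuous g -> mx_continuous (fun N => f N + g N).
Proof.
move=> cf cg e e0; have e20 : 0 < e / 2 by rewrite divr_gt0.
have [d d0 fd] := cf _ e20; have [d' d'0 gd] := cg _ e20.
exists (Num.min d d') => [|N NM]; first by rewrite lt_min d0.
rewrite opprD addrACA (le_lt_trans (ler_normD _ _)) // [ltRHS](splitr e) ltrD //.
  by apply: fd => i j; apply: lt_le_trans (NM i j) _; rewrite ge_min lexx.
by apply: gd => i j; apply: lt_le_trans (NM i j) _; rewrite ge_min lexx orbT.
Qed.

Lemma mx_continuousM f g :
  mx_continuous f -> mx_continuous g -> mx_continuous (fun N => f N * g N).
Proof.
(* Once [f N] is within 1 of [f M], the sum of [|f N|] and [|g M|] is at most [b]. *)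
move=> cf cg e e0; pose b := `|f M| + `|g M| + 1.
have b0 : 0 < b by rewrite ltr_wpDl ?addr_ge0.
have [|d d0 fd] := cf (Num.min 1 (e / 2 / b)).
  by rewrite lt_min ltr01 !divr_gt0.
have [|d' d'0 gd] := cg (Num.min 1 (e / 2 / b)).
  by rewrite lt_min ltr01 !divr_gt0.
exists (Num.min d d') => [|N NM]; first by rewrite lt_min d0.
have : `|f N - f M| < Num.min 1 (e / 2 / b).
  by apply: fd => i j; apply: lt_le_trans (NM i j) _; rewrite ge_min lexx.
have : `|g N - g M| < Num.min 1 (e / 2 / b).
  by apply: gd => i j; apply: lt_le_trans (NM i j) _; rewrite ge_min lexx orbT.
rewrite !lt_min => /andP[_ gNM] /andP[fN1 fNM].
have -> : f N * g N - f M * g M = f N * (g N - g M) + (f N - f M) * g M by ring.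
rewrite (le_lt_trans (ler_normD _ _)) // !normrM.
have fNb : `|f N| <= b - `|g M|.
  rewrite /b -[f N](subrK (f M)) (le_trans (ler_normD _ _)) //; lra.
have gb : `|g M| <= b by rewrite /b; have := normr_ge0 (f M); lra.
set t := e / 2 / b in gNM fNM *.
have bt : b * t = e / 2 by rewrite /t mulrC divfK // gt_eqF.
have := normr_ge0 (f N); have := normr_ge0 (g M).
have := normr_ge0 (f N - f M); have := normr_ge0 (g N - g M).
move: `|f N| `|g M| `|f N - f M| `|g N - g M| fNb gb gNM fNM => x y z w.
move=> xb yb wt zt w0 z0 y0 x0.
apply: (@le_lt_trans _ _ (x * t + t * y)); first by apply: lerD; apply: ler_pM => //; exact: ltW.
have t0 : 0 < t by rewrite /t !divr_gt0.
have : (x + y) * t <= b * t by rewrite ler_pM2r //; lra.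
rewrite bt mulrDl; lra.
Qed.

Lemma mx_continuous_sum (I : Type) (r : seq I) (F : I -> 'M[R]_n -> R) :
  (forall i, mx_continuous (F i)) -> mx_continuous (fun N => \sum_(i <- r) F i N).
Proof.
move=> cF; elim: r => [|i r IHr].
  rewrite (_ : (fun=> _) = (fun=> 0)); first exact: mx_continuous_cst.
  by apply/funext => N; rewrite big_nil.
rewrite (_ : (fun=> _) = (fun N => F i N + \sum_(i <- r) F i N)).
  exact: mx_continuousD.
by apply/funext => N; rewrite big_cons.
Qed.

Lemma mx_continuous_prod (I : Type) (r : seq I) (F : I -> 'M[R]_n -> R) :
  (forall i, mx_continuous (F i)) -> mx_continuous (fun N => \prod_(i <- r) F i N).
Proof.
move=> cF; elim: r => [|i r IHr].
  rewrite (_ : (fun=> _) = (fun=> 1)); first exact: mx_continuous_cst.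
  by apply/funext => N; rewrite big_nil.
rewrite (_ : (fun=> _) = (fun N => F i N * \prod_(i <- r) F i N)).
  exact: mx_continuousM.
by apply/funext => N; rewrite big_cons.
Qed.

Lemma mx_continuous_plucker I : mx_continuous (plucker I).
Proof.
have coef (k l : 'I_#|I|) : mx_continuous (fun N : 'M[R]_n =>
    mxsub (fun r => widen_ord (card_set_le_n I) r) (fun c => enum_val c) N k l).
  rewrite (_ : (fun=> _) = (fun N : 'M_n => N (widen_ord (card_set_le_n I) k) (enum_val l))).
    exact: mx_continuous_coef.
  by apply/funext => N; rewrite mxE.
apply: mx_continuous_sum => s; apply: mx_continuousM; first exact: mx_continuous_cst.
by apply: mx_continuous_prod => i; apply: coef.
Qed.

End Continuity.

(** * Signs of coordinates on the closure and both inclusions *)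

Section Closure.
Variables (R : realType) (n : nat).
Implicit Types (M N L U : 'M[R]_n.+1) (I J : {set 'I_n.+1}).

Lemma plucker_xk_ge0 M k a : (0 < k < n.+1)%N -> 0 < a ->
  (forall I, 0 <= plucker I M) -> forall I, 0 <= plucker I (M *m xk n.+1 k a).
Proof.
move=> kn a0 nnM I; have kn' : (k.-1 < n.+1)%N /\ (k < n.+1)%N by lia.
have adj : adjacent (Ordinal kn'.1) (Ordinal kn'.2) by rewrite /adjacent /=; lia.
have := plucker_addcol M I a adj; rewrite /addcol /= -xkE // => ->.
by case: ifP => _; rewrite ?addr0 // addr_ge0 // mulr_ge0 // ltW.
Qed.

Lemma plucker_xprod_ge0 w a M : (forall k, k \in w -> (0 < k < n.+1)%N) ->
  (forall b, b \in a -> 0 < b) -> (forall I, 0 <= plucker I M) ->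
  forall I, 0 <= plucker I (M *m xprod n.+1 w a).
Proof.
elim: w a M => [|k w IHw] [|b a] M wn apos nnM I /=; rewrite ?mulmx1 //.
rewrite mulmxA; apply: IHw => [l lw|c ca|]; first by apply: wn; rewrite inE lw orbT.
  by apply: apos; rewrite inE ca orbT.
apply: plucker_xk_ge0 => //; first exact: wn (mem_head _ _).
exact: apos (mem_head _ _).
Qed.

(** The submatrix is lower triangular with entries 0 and 1, since the [j]-th term of an increasing
    list is at least [j]. *)
Lemma plucker1_ge0 I : 0 <= plucker I (1%:M : 'M[R]_n.+1).
Proof.
rewrite plucker_pminor; have ss := colseq_ofP I; move: (colseq_of I) ss => s ss.
rewrite (pminorE _ (erefl (size s))) det_trig.
  by apply: prodr_ge0 => i _; rewrite !mxE ler0n.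
apply/is_trig_mxP => i j ij; rewrite !mxE -val_eqE /=.
have js : (nth 0%N s j < n.+1)%N by rewrite (colseq_lt ss) ?mem_nth.
have j_le : (j <= nth 0%N s j)%N.
  case/andP: ss => sorted_s _; have := ltn_ord j; move: (nat_of_ord j).
  elim=> // k IHk ks; apply: leq_ltn_trans (IHk (ltnW ks)) _.
  by apply: (sorted_ltn_nth ltn_trans 0%N sorted_s); rewrite ?inE // ltnW.
by rewrite !inordK ?ltn_eqF //; lia.
Qed.

Lemma mem_w0_word k : k \in w0_word n.+1 -> (0 < k < n.+1)%N.
Proof.
case/flattenP => l /mapP[j jn ->]; rewrite mem_rev.
by move: jn; rewrite !mem_iota /=; lia.
Qed.

Lemma in_Upos_plucker_ge0 U I : in_Upos U -> 0 <= plucker I U.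
Proof.
case=> a [_ [apos ->]]; rewrite -[xprod _ _ _]mul1mx.
by apply: plucker_xprod_ge0 => //; [exact: mem_w0_word | exact: plucker1_ge0].
Qed.

(** The factor depends on [I] only through its size, so a product of two coordinates of equal size
    changes by a nonzero square. *)
Lemma same_flag_plucker M N : same_flag M N -> exists c : nat -> R,
  (forall k, (k <= n.+1)%N -> c k != 0) /\ forall I, plucker I N = c #|I| * plucker I M.
Proof.
case=> L [[uL L0] ->]; exists (lower_scale L); split=> [k kn|I]; last first.
  rewrite !plucker_pminor pminor_lower ?size_colseq_of //.
  by rewrite -size_colseq_of colseq_size // colseq_ofP.
apply/prodf_neq0 => i _.
have : \prod_i L i i != 0.
  rewrite -det_trig; first by move: uL; rewrite unitmxE unitfE.
  by apply/is_trig_mxP.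
by move/prodf_neq0; apply.
Qed.

Lemma closure_plucker_sign M I J : in_Fl_nonneg M -> #|I| = #|J| ->
  0 <= plucker I M * plucker J M.
Proof.
case=> uM clM cIJ; rewrite leNgt; apply/negP => neg.
(* The violating flags form an open saturated set that cannot meet those of [U^+_{>0}]. *)
pose O N := N \in unitmx /\ plucker I N * plucker J N < 0.
have [|||N [[_ negN] [U [UP /same_flag_plucker[c [c0 cP]]]]]] := clM O.
- move=> N [uN negN]; split=> //.
  have cont := mx_continuousM (mx_continuous_plucker N I) (mx_continuous_plucker N J).
  have [|d d0 dP] := cont (- (plucker I N * plucker J N)); first by rewrite oppr_gt0.
  exists d; split=> // N' /dP; rewrite ltr_norml => /andP[_ lt] uN'; split=> //.
  by move: lt; rewrite ltrBlDr addNr.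
- move=> N N' [uN negN] sf; split.
    by case: sf => L [[uL _] ->]; rewrite unitmx_mul uL.
  have [c [c0 cP]] := same_flag_plucker sf.
  rewrite !cP cIJ mulrACA pmulr_rlt0 // -expr2 exprn_even_gt0 //= c0 //.
  by rewrite -[X in (_ <= X)%N]card_ord max_card.
- by split.
move: negN; rewrite !cP cIJ mulrACA; apply/negP; rewrite -leNgt.
apply: mulr_ge0; first by rewrite -expr2 sqr_ge0.
by apply: mulr_ge0; apply: in_Upos_plucker_ge0.
Qed.

Lemma closure_synthetic M : in_Fl_nonneg M -> exists N, [/\ N \in unitmx,
  forall I, 0 <= plucker I N & forall I, (plucker I N != 0) = (plucker I M != 0)].
Proof.
move=> clM; have uM := clM.1.
(* All nonzero coordinates of size [k] share one sign by [closure_plucker_sign]; [eps k] corrects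
   it. *)
pose eps k : R := if [exists I : {set 'I_n.+1}, (#|I| == k) && (plucker I M < 0)] then -1 else 1.
have eps2 k : eps k * eps k = 1 by rewrite /eps; case: ifP; rewrite ?mulrNN mulr1.
have eps0 : eps 0%N = 1.
  rewrite /eps; case: ifP => // /existsP[I /andP[/eqP/cards0_eq ->]].
  by rewrite plucker_pminor /colseq_of enum_set0 /= pminor_nil ltr10.
have epsP I : 0 <= eps #|I| * plucker I M.
  rewrite /eps; case: ifPn => [/existsP[J /andP[/eqP cJ negJ]]|].
    by rewrite mulN1r oppr_ge0 -(nmulr_lge0 _ negJ) closure_plucker_sign.
  by rewrite negb_exists => /forallP/(_ I); rewrite eqxx /= -leNgt mul1r.
(* The product of the first [k] diagonal entries telescopes to [eps k], as [eps 0 = 1] and [eps]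
   squares to 1. *)
pose L : 'M[R]_n.+1 := diag_mx (\row_i (eps i.+1 * eps i)).
have L0 (i j : 'I_n.+1) : (i < j)%N -> L i j = 0.
  by move=> ij; rewrite !mxE -val_eqE /= ltn_eqF // mulr0n.
have Lscale k : (k <= n.+1)%N -> lower_scale L k = eps k.
  rewrite /lower_scale; elim: k => [|k IHk] kn; first by rewrite big_ord0 eps0.
  rewrite big_ord_recr /= IHk ?(ltnW kn) // !mxE eqxx mulr1n inordK //.
  by rewrite mulrCA eps2 mulr1.
have PN I : plucker I (L *m M) = eps #|I| * plucker I M.
  have le_I := colseq_size (colseq_ofP I).
  by rewrite !plucker_pminor pminor_lower // Lscale // size_colseq_of.
exists (L *m M); split=> [|I|I]; rewrite ?PN //.
  rewrite unitmx_mul uM andbT unitmxE unitfE det_diag; apply/prodf_neq0 => i _.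
  by rewrite mxE; apply/negP => /eqP e; move: (eps2 i.+1) (eps2 i); nra.
rewrite mulf_eq0 negb_or; suff -> : eps #|I| != 0 by [].
by apply/negP => /eqP e; move: (eps2 #|I|); rewrite e mul0r => /esym/eqP; rewrite oner_eq0.
Qed.

Lemma synthetic_closure M : M \in unitmx -> (forall I, 0 <= plucker I M) -> in_Fl_nonneg M.
Proof.
move=> uM nnM; split=> // O openO _ OM.
have [_ [e [e0 eP]]] := openO M OM.
have [N [uN posN distN]] := perturb_positive uM nnM e0.
exists N; split; first exact: eP.
apply: positive_rep_Upos_flag => s /colseqP[I <-].
by rewrite -plucker_pminor.
Qed.

End Closure.

Theorem theorem3 (R : realType) (n : nat) (hn : (2 <= n)%N)
    (S : {set {set 'I_n}}) :
  synthetic_flag_positroid R S <-> realizable_flag_positroid R S.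
Proof.
case: n hn S => // n _ S; split.
  by case=> M [uM [nnM ->]]; exists M; split=> //; apply: synthetic_closure.
case=> M [/closure_synthetic[N [uN nnN NM]] ->]; exists N; split=> //; split=> //.
by apply/setP => I; rewrite !inE NM.
Qed.
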